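(* Let $r\geq 2$ and $t\geq 1$ be integers and let $\mathcal{H}_1,\ldots,\mathcal{H}_t$ be finite hypergraphs, none of which has $\emptyset$ as an edge. Then $$\chi\left(\operatorname{KG}^r(\mathcal{H}_1)\times\cdots\times\operatorname{KG}^r(\mathcal{H}_t)\right)\geq\frac{1}{r-1}\min_{\ell=1,\ldots,t}\left(|V(\mathcal{H}_\ell)|-\operatorname{alt}_r(\mathcal{H}_\ell)\right).$$
   Context: A hypergraph $\mathcal{H}=(V,E)$ consists of a finite vertex set $V$ and a set $E$ of subsets of $V$. A proper coloring assigns colors to vertices so that no edge is monochromatic; $\chi$ denotes the minimum number of colors of a proper coloring. For $X\subseteq V$, $\mathcal{H}[X]$ has vertex set $X$ and edge set $\{e\in E: e\subseteq X\}$. $\operatorname{KG}^r(\mathcal{H})$ has vertex set $E(\mathcal{H})$ and edges all sets $\{e_1,\ldots,e_r\}$ of $r$ pairwise disjoint edges of $\mathcal{H}$. The categorical product $\mathcal{G}_1\times\cdots\times\mathcal{G}_t$ of hypergraphs $\mathcal{G}_\ell=(V_\ell,E_\ell)$ has vertex set $V_1\times\cdots\times V_t$, and $F\subseteq V_1\times\cdots\times V_t$ is an edge iff for every $\ell$ the projection of $F$ onto the $\ell$-th coordinate is an edge of $\mathcal{G}_\ell$. Alternation number: $Z_r$ is the multiplicative group of $r$-th roots of unity with generator $\omega$. For $\boldsymbol{x}=(x_1,\ldots,x_n)\in(Z_r\cup\{0\})^n$, $\operatorname{supp}_j(\boldsymbol{x})=\{i: x_i=\omega^j\}$. An alternating sequence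 is a sequence of elements of $Z_r$ in which any two consecutive terms differ. For a permutation $\pi$ of $[n]$, $\operatorname{alt}_\pi(\boldsymbol{x})$ is the maximum length of an alternating subsequence of $x_{\pi(1)},\ldots,x_{\pi(n)}$ (using only nonzero entries; it is $0$ for the zero vector). Identifying $V(\mathcal{H})$ with $[n]$, $$\operatorname{alt}_r(\mathcal{H})=\min_{\pi\in\mathcal{S}_n}\max\{\operatorname{alt}_\pi(\boldsymbol{x}): \boldsymbol{x}\in(Z_r\cup\{0\})^n,\ E(\mathcal{H}[\operatorname{supp}_j(\boldsymbol{x})])=\emptyset \text{ for } j=1,\ldots,r\}.$$ *)

(* Defs.v *)
From mathcomp Require Import all_boot perm.

Set Implicit Arguments.
Unset Strict Implicit.
Unset Printing Implicit Defensive.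

Section Minimum.
Variables (I : finType) (f : I -> nat).

(* The minimum of [f] when [I] is inhabited: starting the iteration from the
   maximum of [f] does not affect the result. *)
Definition min_over : nat := \big[minn/(\max_i f i)]_i f i.

Lemma min_over_le i : min_over <= f i.
Proof.
rewrite /min_over; move: (\max_j f j) (mem_index_enum i) => m.
elim: (index_enum I) => // j s IH; rewrite inE big_cons => /orP[/eqP->|/IH].
  exact: geq_minl.
exact: leq_trans (geq_minr _ _).
Qed.

Lemma min_over_attained (i0 : I) : exists i, min_over = f i.
Proof.
have [i im] : exists i, \max_j f j = f i.
  have [|i _ ->] := @eq_bigmax_cond I predT f; last by exists i.
  by apply/card_gt0P; exists i0.
rewrite /min_over {}im; elim: (index_enum I) => [|j s [k IH]].
  by rewrite big_nil; exists i.
by rewrite big_cons IH /minn; case: ifP => _; [exists j | exists k].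
Qed.

End Minimum.

Record hypergraph := Hypergraph {
  vertex : finType;
  edges : {set {set vertex}}
}.

Definition proper_coloring (H : hypergraph) (C : eqType) (c : vertex H -> C) :
    bool :=
  [forall e in edges H, [exists u in e, [exists v in e, c u != c v]]].

Definition colorable (H : hypergraph) (k : nat) : bool :=
  [exists c : {ffun vertex H -> 'I_k}, proper_coloring c].

(* A hypergraph with a proper coloring has one with at most #|V| colors, so the
   minimum is searched among 0, ..., #|V|.  The value is #|V| when an edge with
   at most one vertex makes every coloring improper. *)
Definition chi (H : hypergraph) : nat :=
  [arg min_(k < ord_max : 'I_#|vertex H|.+1 | colorable H k) k].

Lemma colorableP (H : hypergraph) (k : nat) :
  reflect (exists c : vertex H -> 'I_k, proper_coloring c) (colorable H k).
Proof.
apply: (iffP existsP) => [[c hc]|[c hc]]; first by exists c.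
exists (finfun c); apply/forall_inP => e he.
have /exists_inP[u ue /exists_inP[v ve uv]] := forall_inP hc e he.
by apply/exists_inP; exists u => //; apply/exists_inP; exists v; rewrite ?ffunE.
Qed.

Lemma colorable_card (H : hypergraph) :
  colorable H #|vertex H| = [forall e in edges H, 1 < #|e|].
Proof.
apply/colorableP/forall_inP => [[c /forall_inP hc] e /hc|hE].
  case/exists_inP=> u ue /exists_inP[v ve uv]; apply/card_gt1P.
  by exists u, v; split=> //; apply: contraNneq uv => ->.
exists enum_rank; apply/forall_inP => e /hE /card_gt1P[u [v [ue ve uv]]].
apply/exists_inP; exists u => //; apply/exists_inP; exists v => //.
by rewrite (inj_eq enum_rank_inj).
Qed.

Lemma chi_min (H : hypergraph) (k : nat) :
  colorable H k -> colorable H (chi H) /\ chi H <= k.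
Proof.
move=> hk; have hmax : colorable H #|vertex H|.
  rewrite colorable_card; apply/forall_inP => e he.
  have [c /forall_inP/(_ e he)] := colorableP _ _ hk.
  case/exists_inP=> u ue /exists_inP[v ve uv]; apply/card_gt1P.
  by exists u, v; split=> //; apply: contraNneq uv => ->.
rewrite /chi; case: arg_minnP => // i hi hmin; split=> //.
case: (leqP k #|vertex H|) => [kle|klt]; last first.
  by apply: leq_trans (ltnW klt); rewrite -ltnS.
exact: (hmin (Ordinal (kle : k < #|vertex H|.+1))).
Qed.

Definition KG (r : nat) (H : hypergraph) : hypergraph :=
  @Hypergraph {e : {set vertex H} | e \in edges H}
    [set S : {set {e : {set vertex H} | e \in edges H}} |
      (#|S| == r) &&
      [forall e in S, [forall f in S,
        (e != f) ==> [disjoint val e & val f]]]].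

Definition cat_prod (t : nat) (G : 'I_t -> hypergraph) : hypergraph :=
  @Hypergraph {dffun forall l : 'I_t, vertex (G l)}
    [set F : {set {dffun forall l : 'I_t, vertex (G l)}} |
      [forall l : 'I_t,
        [set x l | x : {dffun forall l : 'I_t, vertex (G l)} in F]
          \in edges (G l)]].

Lemma cat_prod_KG_colorable (r t : nat) (H : 'I_t -> hypergraph) :
  2 <= r -> 1 <= t ->
  let G := cat_prod (fun l => KG r (H l)) in colorable G #|vertex G|.
Proof.
move=> r2 t1; rewrite /= colorable_card; apply/forall_inP => F.
rewrite inE => /forallP/(_ (Ordinal t1)); rewrite inE => /andP[/eqP cr _].
by apply: leq_trans r2 _; rewrite -{}cr; apply: leq_imset_card.
Qed.

Section Alternation.
Variable r : nat.

Definition alternating (s : seq 'I_r) : bool := sorted (fun a b => a != b) s.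

Definition max_alternating (s : seq 'I_r) : nat :=
  \max_(m : (size s).-tuple bool | alternating (mask m s)) size (mask m s).

Section SignVectors.
Variable V : finType.

(* [Some j] stands for the root of unity omega^j (j = 0, ..., r-1, exponents
   being modulo r) and [None] for 0. *)
Definition sign_vector := {ffun V -> option 'I_r}.

Definition supp (j : 'I_r) (x : sign_vector) : {set V} :=
  [set v | x v == Some j].

(* [enum V] provides the identification of [V] with {1, ..., n}. *)
Definition alt_perm (pi : {perm V}) (x : sign_vector) : nat :=
  max_alternating (pmap id [seq x (pi v) | v <- enum V]).

Lemma alt_perm_le_card (pi : {perm V}) (x : sign_vector) :
  alt_perm pi x <= #|V|.
Proof.
apply/bigmax_leqP => m _; rewrite size_mask ?size_tuple //.
apply: leq_trans (count_size _ _) _; rewrite size_tuple size_pmap.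
by apply: leq_trans (count_size _ _) _; rewrite size_map cardE.
Qed.

End SignVectors.

Definition induced_edges (H : hypergraph) (X : {set vertex H}) :
    {set {set vertex H}} :=
  [set e in edges H | e \subset X].

Definition alt (H : hypergraph) : nat :=
  min_over (fun pi : {perm vertex H} =>
    \max_(x : sign_vector (vertex H) |
            [forall j, induced_edges (supp j x) == set0])
      alt_perm pi x).

Lemma alt_le_card (H : hypergraph) : alt H <= #|vertex H|.
Proof.
apply: leq_trans (min_over_le _ (perm_one _)) _.
by apply/bigmax_leqP => x _; apply: alt_perm_le_card.
Qed.

End Alternation.

(* Main.v *)
(* For a finite set [G] of signs, a colouring of [E_1 x ... x E_t] with
   fewer than [min (n_l - alt_l) / (#|G| - 1)] colours
   has #|G| tuples of equal colour that are pairwise disjoint in every coordinate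
   (an edge of the product of a special kind).  This property is multiplicative in
   #|G|: over [G1 * G2], apply the [G2] case inside the vertex sets whose own
   deficiency is large and the [G1] case to the hypergraph of these sets.
   For #|G| = p prime, a colouring without such tuples would give an equivariant
   sign on nonzero sign vectors over the disjoint union of the vertex sets.  Some
   full flag of vectors has distinct consecutive signs, because the cyclic group
   has a resolution in the join of its copies; on the other hand the sign can only
   change when a monotone rank increases, and that rank stays below the dimension.
   Vectors which have an edge in every part in every coordinate are ranked by the
   number of pairs (sign, colour) which they contain, and the others by their
   alternation numbers and the numbers of parts containing an edge. *)

Require Import Defs.
From HB Require Import structures.
From mathcomp Require Import all_boot all_order all_algebra perm zify.

Set Implicit Arguments.
Unset Strict Implicit.
Unset Printing Implicit Defensive.

Import Order.TTheory GRing.Theory Num.Theory.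

(** * Coboundaries and barycentric subdivision of ordered simplices *)

Section Boundary.
Local Open Scope ring_scope.
Variable R : pzRingType.

(** The simplicial coboundary of [f] at [x]: the alternating sum over the faces of [x] that omit one
    vertex. *)
Fixpoint bd (T : Type) (f : seq T -> R) (x : seq T) : R :=
  if x is a :: l then f l - bd (fun y => f (a :: y)) l else 0.

Lemma eq_bd_size (T : Type) n (f g : seq T -> R) :
  (forall y, size y = n -> f y = g y) ->
  forall x, size x = n.+1 -> bd f x = bd g x.
Proof.
move=> fg x; elim: x n f g fg => //= a l IH n f g fg [sl].
rewrite fg //; case: n => [|n] in fg sl *; first by rewrite (size0nil sl).
by congr (_ - _); apply: (IH n) => // y sy; apply: fg; rewrite /= sy.
Qed.

Lemma eq_bd (T : Type) (f g : seq T -> R) : f =1 g -> bd f =1 bd g.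
Proof. by move=> fg [//|a l]; apply: (@eq_bd_size _ (size l)) => // y _; apply: fg. Qed.

Lemma bd0 (T : Type) (x : seq T) : bd (fun=> 0 : R) x = 0.
Proof. by elim: x => //= a l ->; rewrite subrr. Qed.

Lemma bdB (T : Type) (f g : seq T -> R) x :
  bd (fun y => f y - g y) x = bd f x - bd g x.
Proof.
elim: x f g => [|a l IH] f g /=; first by rewrite subrr.
by rewrite IH !opprB addrACA [RHS]addrACA [- g l + _]addrC.
Qed.

Lemma bd_sum (T : Type) (I : finType) (f : I -> seq T -> R) x :
  bd (fun y => \sum_i f i y) x = \sum_i bd (f i) x.
Proof.
elim: x f => [|a l IH] f /=; first by rewrite big1.
by rewrite IH -sumrB.
Qed.

Lemma bd_bd (T : Type) (f : seq T -> R) x : bd (bd f) x = 0.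
Proof.
elim: x f => [|a l IH] f //=.
by rewrite bdB IH subr0 subrr.
Qed.

Lemma bd_map (T U : Type) (h : T -> U) (f : seq U -> R) x :
  bd (fun y => f (map h y)) x = bd f (map h x).
Proof. by elim: x f => [|a l IH] f //=; rewrite (IH (fun y => f (h a :: y))). Qed.

(* The value of [b] on the barycentric subdivision of the simplex [x] with [n]
   vertices, whose facets are the flags [x = x_n, x_(n-1), ..., x_1] of faces. *)
Fixpoint sd (T : Type) n (b : seq (seq T) -> R) (x : seq T) : R :=
  if n is m.+1 then bd (sd m (fun q => b (x :: q))) x else b [::].

Lemma eq_sd (T : Type) n (b c : seq (seq T) -> R) :
  (forall q, size q = n -> b q = c q) -> sd n b =1 sd n c.
Proof.
elim: n b c => [|n IH] b c bc x /=; first exact: bc.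
by apply: eq_bd => y; apply: IH => q sq; apply: bc; rewrite /= sq.
Qed.

Lemma sdB (T : Type) n (b c : seq (seq T) -> R) x :
  sd n (fun q => b q - c q) x = sd n b x - sd n c x.
Proof.
by elim: n b c x => [|n IH] b c x //=; rewrite -bdB; apply: eq_bd => y.
Qed.

Lemma sd_sum (T : Type) (I : finType) n (b : I -> seq (seq T) -> R) x :
  sd n (fun q => \sum_i b i q) x = \sum_i sd n (b i) x.
Proof.
by elim: n b x => [|n IH] b x //=; rewrite -bd_sum; apply: eq_bd => y.
Qed.

(** Omitting [x] from the flags it heads yields the right-hand side; by induction the other
    omissions yield a double boundary, hence 0. *)
Lemma sd_bd (T : Type) n (b : seq (seq T) -> R) x :
  sd n.+1 (bd b) x = bd (sd n b) x.
Proof.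
elim: n b x => [|n IH] b x.
  by rewrite /=; elim: x => //= a l ->; rewrite subr0.
rewrite [LHS]/= (eq_bd (g := fun y => sd n.+1 b y -
  sd n.+1 (bd (fun q => b (x :: q))) y)); last by move=> y; rewrite -sdB.
rewrite bdB [X in _ - X](eq_bd (IH _)) bd_bd subr0 //.
Qed.

Inductive flag (T : Type) : seq T -> seq (seq T) -> Prop :=
| flag_nil : flag [::] [::]
| flag_cons l1 a l2 q : flag (l1 ++ l2) q ->
    flag (l1 ++ a :: l2) ((l1 ++ a :: l2) :: q).

Lemma bd_neq0 (T : Type) (f : seq T -> R) x : bd f x != 0 ->
  exists l1 a l2, x = l1 ++ a :: l2 /\ f (l1 ++ l2) != 0.
Proof.
elim: x f => [|a l IH] f /=; first by rewrite eqxx.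
have [->|fl _] := eqVneq (f l) 0; last by exists [::], a, l.
rewrite sub0r oppr_eq0 => /IH[l1 [b [l2 [-> h]]]].
by exists (a :: l1), b, l2.
Qed.

Lemma sd_neq0 (T : Type) n (b : seq (seq T) -> R) x :
  size x = n -> sd n b x != 0 -> exists2 q, flag x q & b q != 0.
Proof.
elim: n b x => [|n IH] b x.
  by move/size0nil-> => /= h; exists [::] => //; constructor.
move=> sx /bd_neq0[l1 [a [l2 [xE]]]].
case/IH => [|q fq bq]; first by move: sx; rewrite xE !size_cat /= addnS => -[].
by exists (x :: q) => //; rewrite xE; constructor.
Qed.

End Boundary.

(** * Operators of the periodic resolution of a cyclic group *)

Section CyclicOperators.
Local Open Scope ring_scope.
Variables (R : pzRingType) (p : nat).

(* The operators of the periodic free resolution of the cyclic group of order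
   [p], acting on functions of [X] through [h]: [tau - 1] and the norm,
   alternately. *)
Definition cyc (X : Type) (h : X -> X) n (f : X -> R) (x : X) : R :=
  if n == 0 then f x
  else if odd n then f (h x) - f x else \sum_(i < p) f (iter i h x).

Lemma cyc_cyc (X : Type) (h : X -> X) n (f : X -> R) x :
  (forall y, iter p h y = y) -> cyc h n.+1 (cyc h n.+2 f) x = 0.
Proof.
move=> hp; rewrite /cyc /= negbK.
have tele : \sum_(i < p) f (iter i.+1 h x) = \sum_(i < p) f (iter i h x).
  case: p hp => [|k] hp; first by rewrite !big_ord0.
  by rewrite big_ord_recr big_ord_recl /= -[in f x](hp x) addrC.
case: (odd n) => /=.
  rewrite -[RHS](subrr (\sum_(i < p) f (iter i h x))) -{1}tele -sumrB.
  by apply: eq_bigr.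
rewrite -tele; apply/eqP; rewrite subr_eq0; apply/eqP/eq_bigr => i _.
by rewrite -iterSr.
Qed.

Lemma eq_cyc (X : Type) (h : X -> X) n (f g : X -> R) :
  f =1 g -> cyc h n f =1 cyc h n g.
Proof.
move=> fg x; rewrite /cyc; case: ifP => // _; case: ifP => _; first by rewrite !fg.
by apply: eq_bigr.
Qed.

Lemma cycB (X : Type) (h : X -> X) n (f g : X -> R) x :
  cyc h n (fun y => f y - g y) x = cyc h n f x - cyc h n g x.
Proof.
rewrite /cyc; case: ifP => // _; case: ifP => _; last by rewrite -sumrB.
by rewrite !opprB addrACA [RHS]addrACA [- g _ + _]addrC.
Qed.

Lemma iter_map (T : Type) (h : T -> T) i (x : seq T) :
  iter i (map h) x = map (iter i h) x.
Proof. by elim: i => [|i IH] /=; rewrite ?map_id // IH -map_comp. Qed.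

Lemma bd_cyc (T : Type) (h : T -> T) n (f : seq T -> R) x :
  bd (cyc (map h) n f) x = cyc (map h) n (bd f) x.
Proof.
rewrite /cyc; case: ifP => // _; case: ifP => _.
  by rewrite bdB bd_map.
rewrite (bd_sum (fun (i : 'I_p) y => f (iter i (map h) y))).
apply: eq_bigr => i _; rewrite iter_map -bd_map.
by apply: eq_bd => y; rewrite iter_map.
Qed.

End CyclicOperators.

(** * A Fan-type lemma for equivariant signs in a cyclic group *)

Section FanLemma.
Local Open Scope ring_scope.
Variables (k : nat) (V : Type).
Local Notation F := 'I_k.+2.
Local Notation shift := (map (fun a : V * F => (a.1, a.2 + 1))).
Local Notation incr := (map (fun z : F => z + 1)).

Lemma iter_incr i (a : seq F) : iter i incr a = map (fun z => z + i%:R) a.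
Proof.
rewrite iter_map; apply: eq_map => z.
by elim: i => [|i IH] /=; rewrite ?addr0 // IH -addrA -natr1.
Qed.

Lemma natr_card_Zp : k.+2%:R = 0 :> F.
Proof. exact: (@pchar_Zp k.+2). Qed.

Lemma iter_shift_card (x : seq (V * F)) : iter k.+2 shift x = x.
Proof.
rewrite iter_map -[RHS]map_id; apply: eq_map => -[v z].
suff it i : iter i (fun a : V * F => (a.1, a.2 + 1)) (v, z) = (v, z + i%:R).
  by rewrite it natr_card_Zp addr0.
by elim: i => [|i IH]; rewrite ?addr0 // iterS IH /= -addrA -natr1.
Qed.

Lemma cyc_neq0 (X : Type) (h : X -> X) n (f : X -> F) x :
  cyc k.+2 h n f x != 0 -> exists i, f (iter i h x) != 0.
Proof.
rewrite /cyc; case: ifP => _; first by exists 0.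
case: ifP => _; last first.
  case: (pickP (fun i : 'I_k.+2 => f (iter i h x) != 0)) => [i fi _|f0].
    by exists i.
  by rewrite big1 ?eqxx // => i _; apply/eqP; rewrite -[_ == _]negbK f0.
have [fx|fx _] := eqVneq (f x) 0; last by exists 0.
by rewrite fx subr0; exists 1.
Qed.

(* The pairing of [g] with a chain of the join of [size vs] copies of the cyclic
   group; these chains form a resolution, as [join_bd] expresses. *)
Fixpoint join (vs : seq V) (g : seq (V * F) -> F) : F :=
  if vs is v :: vs' then
    join vs' (cyc k.+2 shift (size vs') (fun l => g ((v, 0) :: l)))
  else g [::].

Lemma eq_join vs f g : f =1 g -> join vs f = join vs g.
Proof.
elim: vs f g => [|v vs IH] f g fg /=; first exact: fg.
by apply: IH; apply: eq_cyc => l; apply: fg.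
Qed.

Lemma joinB vs f g : join vs (fun l => f l - g l) = join vs f - join vs g.
Proof.
elim: vs f g => [//|v vs IH] f g /=; rewrite -IH; apply: eq_join => l.
exact: cycB.
Qed.

Lemma join0 vs : join vs (fun=> 0) = 0.
Proof.
rewrite -[RHS](subrr (join vs (fun=> 0))) -joinB.
by apply: eq_join => l; rewrite subrr.
Qed.

Lemma join_neq0 vs g : join vs g != 0 ->
  exists2 l, [seq a.1 | a <- l] = vs & g l != 0.
Proof.
elim: vs g => [|v vs IH] g /=; first by exists [::].
move=> /IH[l lE nz]; have [i gi] := cyc_neq0 nz; eexists; last exact: gi.
rewrite /= -{}lE; congr (_ :: _).
by elim: i {gi} => //= i <-; rewrite -map_comp.
Qed.

(** Omitting the first vertex [(v, 0)] gives the right-hand side. By induction the other faces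
    contribute two consecutive operators, which compose to 0. *)
Lemma join_bd v vs f : join (v :: vs) (bd f) = join vs (cyc k.+2 shift (size vs) f).
Proof.
elim: vs v f => [|w vs IH] v f; first by rewrite /= /cyc /= subr0.
transitivity (join (w :: vs) (fun l => cyc k.+2 shift (size vs).+1 f l -
    bd (cyc k.+2 shift (size vs).+1 (fun y => f ((v, 0) :: y))) l)).
  apply: (@eq_join (w :: vs)) => l; rewrite bd_cyc -cycB; exact: eq_cyc.
rewrite joinB IH [X in _ - X](_ : _ = 0) ?subr0 //.
case: vs {IH} => [|w' vs]; first by rewrite /cyc /= subrr.
rewrite -[RHS](join0 (w' :: vs)); apply: eq_join => l.
by rewrite cyc_cyc //; apply: iter_shift_card.
Qed.

Local Notation alternates := (sorted (fun y z : F => y != z)).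

(** Vanishing on degenerate simplices is what turns a nonzero pairing into an alternating flag. *)
Definition normalized (u : seq F -> F) := forall a, ~~ alternates a -> u a = 0.

(** If two neighbours agree, the faces omitting one or the other cancel, and every other face keeps
    the repetition. *)
Lemma normalized_bd u : normalized u -> normalized (bd u).
Proof.
move=> nu a; elim: a u nu => [//|y l IH] u nu /=.
case: l IH => [//|z l] IH; rewrite /= negb_and negbK => /orP[/eqP->|nl].
  rewrite opprB addrCA subrr addr0 (_ : bd _ l = 0) // -[RHS](bd0 _ l).
  by apply: eq_bd => x; apply: nu; rewrite /= eqxx.
rewrite (nu (z :: l)) // sub0r; apply/eqP; rewrite oppr_eq0; apply/eqP.
apply: (IH (fun x => u (y :: x))) => // x nx; apply: nu.
by case: x nx => //= ? x nx; rewrite negb_and nx orbT.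
Qed.

Lemma sorted_incr (c : F) a : alternates [seq z + c | z <- a] = alternates a.
Proof.
by rewrite sorted_map; apply: eq_sorted => y z /=; rewrite (inj_eq (addIr _)).
Qed.

(** This is exactness of the periodic resolution: [incr] acts freely on nonempty sequences, and each
    orbit has one representative with head 0. *)
Lemma cyc_primitive n u : normalized u ->
  (forall a, size a = n.+1 -> cyc k.+2 incr n.+2 u a = 0) ->
  exists2 b, normalized b & forall a, size a = n.+1 -> cyc k.+2 incr n.+1 b a = u a.
Proof.
move=> nu; rewrite {1}/cyc /= negbK; case: (boolP (odd n)) => /= odn uD.
  (* Here [u] is invariant, so it is the norm of its restriction to the representatives. *)
  exists (fun a => if head 0 a == 0 then u a else 0).
    by move=> a na; case: ifP => // _; apply: nu.
  move=> a sa; rewrite /cyc /= odn /=.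
  have uI i : u (iter i incr a) = u a.
    elim: i => //= i <-; apply/eqP; rewrite -subr_eq0 uD //.
    by elim: i => //= i <-; rewrite size_map.
  case: a => [//|y a] in sa uI *.
  have [j _ ij] : exists2 j : 'I_k.+2, true & j%:R = - y :> F.
    by exists (- y) => //; rewrite natr_Zp.
  rewrite (bigD1 j) //= big1 ?addr0 => [|i ni].
    by rewrite uI iter_incr /= ij addrN eqxx.
  rewrite iter_incr /= ifF //; apply/eqP => yi; case/eqP: ni; apply: val_inj.
  have /(congr1 val) : i%:R = j%:R :> F by apply: (addrI y); rewrite yi ij addrN.
  by rewrite !Zp_nat /= !modn_small.
(* Here the norm of [u] vanishes: partial sums along an orbit, started at its representative
   [base a], have difference [u], also where the head wraps around to 0. *)
pose base (a : seq F) : seq F := [seq z - head 0 a | z <- a].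
exists (fun a : seq F => \sum_(i < (head 0 a : F)) u (iter i incr (base a))).
  move=> a na; apply: big1 => i _; apply: nu.
  by rewrite iter_incr sorted_incr sorted_incr.
move=> a sa; rewrite /cyc /= odn.
case: a sa => [//|y a] sa; set x := y :: a.
have bI : base (incr x) = base x.
  rewrite /base /x /= -map_comp; congr (_ :: _).
    by rewrite !subrr.
  by apply: eq_map => z /=; rewrite opprD addrACA subrr addr0.
have bK : iter y incr (base x) = x.
  rewrite iter_incr /base -map_comp -[RHS]map_id; apply: eq_map => z /=.
  by rewrite natr_Zp subrK.
rewrite bI [head 0 x]/= [head 0 (incr x)]/=.
have vy : val (y + 1) = (y.+1 %% k.+2)%N.
  by rewrite /= modnDmr addn1.
rewrite -[nat_of_ord (y + 1)]/(val (y + 1)) vy.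
have := ltn_ord y; rewrite leq_eqVlt => /orP[/eqP yk|yk].
  rewrite yk modnn big_ord0 sub0r.
  have : \sum_(i < y.+1) u (iter i incr (base x)) = 0 by rewrite yk uD ?size_map.
  by rewrite big_ord_recr /= bK addrC => /eqP; rewrite addr_eq0 => /eqP.
by rewrite modn_small // big_ord_recr /= bK addrC addrK.
Qed.

Variable s : seq (V * F) -> F.
Hypothesis s_shift : forall a l, s (shift (a :: l)) = s (a :: l) + 1.

Lemma sd_shift n (b : seq F -> F) x :
  sd n (fun q => b (map s q)) (shift x) = sd n (fun q => b (incr (map s q))) x.
Proof.
elim: n b x => [//|n IH] b [//|a l]; move: (a :: l) (s_shift a l) => x sx /=.
rewrite -bd_map; apply: eq_bd => y.
by rewrite (IH (fun q => b (s (shift x) :: q))); apply: eq_sd => q _; rewrite sx.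
Qed.

Lemma sd_iter_shift n (b : seq F -> F) i x :
  sd n (fun q => b (map s q)) (iter i shift x) =
  sd n (fun q => b (iter i incr (map s q))) x.
Proof.
elim: i b => [//|i IH] b; rewrite iterS sd_shift.
by rewrite (IH (fun q => b (incr q))).
Qed.

Lemma sd_cyc m n (b : seq F -> F) x :
  sd m (fun q => cyc k.+2 incr n b (map s q)) x =
  cyc k.+2 shift n (sd m (fun q => b (map s q))) x.
Proof.
rewrite /cyc; case: ifP => // _; case: ifP => _; first by rewrite sdB sd_shift.
rewrite (sd_sum _ (fun (i : 'I_k.+2) q => b (iter i incr (map s q)))).
by apply: eq_bigr => i _; rewrite sd_iter_shift.
Qed.

Definition pairing vs (b : seq F -> F) : F :=
  join vs (sd (size vs) (fun q => b (map s q))).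

Lemma eq_pairing vs b c :
  (forall a, size a = size vs -> b a = c a) -> pairing vs b = pairing vs c.
Proof.
by move=> bc; apply: eq_join; apply: eq_sd => q sq; apply: bc; rewrite size_map.
Qed.

(** The coboundary passes through [s] and the subdivision to the join; the operator produced by
    [join_bd] passes back because [s] is equivariant. *)
Lemma pairing_bd v vs b :
  pairing (v :: vs) (bd b) = pairing vs (cyc k.+2 incr (size vs) b).
Proof.
rewrite /pairing [size (v :: vs)]/=.
rewrite (eq_join _ (g := bd (sd (size vs) (fun q => b (map s q))))).
  by rewrite join_bd; apply: eq_join => l; rewrite sd_cyc.
by move=> l; rewrite -sd_bd; apply: eq_sd => q _; rewrite bd_map.
Qed.

(** Each new copy raises the degree of the cocycle by one: [cyc_primitive] writes [u] as an operator
    applied to [b], the next cocycle is [bd b], and [pairing_bd] preserves the value 1. *)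
Lemma pairing_nontrivial v vs : exists u,
  [/\ normalized u,
      forall a, size a = (size vs).+1 -> cyc k.+2 incr (size vs).+2 u a = 0,
      forall a, size a = (size vs).+2 -> bd u a = 0 & pairing (v :: vs) u = 1].
Proof.
elim: vs v => [|w vs IH] v.
  exists (fun a => (alternates a)%:R);
    split=> [a /negbTE->//|[|y [|//]] // _|[|y [|z [|//]]] // _|].
  - rewrite /cyc /= (eq_bigr (fun=> 1)) => [|i _]; last by rewrite iter_incr.
    by rewrite sumr_const card_ord natr_card_Zp.
  - by rewrite /= subr0 subrr.
  by rewrite /pairing /= /cyc /= subr0.
have [u [nu uD ud uE]] := IH w.
have [b nb bE] := cyc_primitive nu uD.
exists (bd b); split; first exact: normalized_bd.
- move=> a sa; rewrite -bd_cyc -[RHS](ud _ sa).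
  apply: (eq_bd_size (n := (size vs).+1)) => // y sy.
  by rewrite -bE // /cyc /= !negbK.
- by move=> a _; rewrite bd_bd.
by rewrite pairing_bd -[RHS]uE; apply: eq_pairing => a sa; rewrite bE.
Qed.

(* A form of Ky Fan's lemma when [k = 0]. *)
Lemma fan_flag vs : exists l q,
  [/\ [seq a.1 | a <- l] = vs, flag l q & alternates (map s q)].
Proof.
case: vs => [|v vs]; first by exists [::], [::]; split=> //; constructor.
have [u [nu _ _ uE]] := pairing_nontrivial v vs.
have : pairing (v :: vs) u != 0 by rewrite uE oner_neq0.
case/join_neq0 => l lE /sd_neq0[|q fq uq]; first by rewrite -lE size_map.
by exists l, q; split=> //; apply: contraNT uq => /nu->.
Qed.

End FanLemma.

(** * Sign vectors as simplices, and a Tucker-type lemma *)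

Section Levels.
Local Open Scope ring_scope.
Variables (k : nat) (W : finType).
Local Notation F := 'I_k.+2.
Local Notation vector := {ffun W -> option F}.

Definition subv (G : eqType) (x y : {ffun W -> option G}) : bool :=
  [forall w, x w ==> (x w == y w)].

Lemma subvP (G : eqType) (x y : {ffun W -> option G}) :
  reflect (forall w j, x w = Some j -> y w = Some j) (subv x y).
Proof.
apply: (iffP forallP) => xy w => [j xw|].
  by have := xy w; rewrite xw => /eqP<-.
by case xw : (x w) => [j|] //=; rewrite (xy _ _ xw).
Qed.

Definition translate (G : zmodType) (c : G) (x : {ffun W -> option G}) :
    {ffun W -> option G} :=
  [ffun w => omap (fun z => z + c) (x w)].

Fixpoint lookup (l : seq (W * F)) (w : W) : option F :=
  if l is a :: l' then if a.1 == w then Some a.2 else lookup l' w else None.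

Definition vector_of (l : seq (W * F)) : vector := [ffun w => lookup l w].

Lemma lookup_some l w : isSome (lookup l w) = (w \in [seq a.1 | a <- l]).
Proof.
elim: l => //= a l IH; rewrite inE eq_sym.
by case: eqP.
Qed.

Lemma lookupE l w j : uniq [seq a.1 | a <- l] ->
  (lookup l w == Some j) = ((w, j) \in l).
Proof.
elim: l => //= -[v z] l IH /= /andP[vl ul]; rewrite inE xpair_eqE [w == v]eq_sym.
case: (v =P w) => [<-|_] /=; last exact: IH.
rewrite [(v, j) \in l](contraNF _ vl) ?orbF 1?eq_sym //.
by move=> vj; apply/mapP; exists (v, j).
Qed.

Lemma vector_of_shift l :
  vector_of [seq (a.1, a.2 + 1) | a <- l] = translate 1 (vector_of l).
Proof.
apply/ffunP => w; rewrite !ffunE.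
by elim: l => //= a l IH; case: eqP.
Qed.

Lemma card_vector_of l : uniq [seq a.1 | a <- l] ->
  #|[set w | vector_of l w]| = size l.
Proof.
move=> /card_uniqP; rewrite size_map => <-; apply: eq_card => w.
by rewrite inE ffunE lookup_some.
Qed.

(** Consecutive signs differ along the flag from [fan_flag]. At each step up, either the level grows
    or, by the last hypothesis, it already bounds the support; so it never falls below the number of
    nonzero entries. *)
Lemma tucker_level (s : vector -> F) (lev : vector -> nat) :
  (forall x : vector, [exists w, x w] -> s (translate 1 x) = s x + 1) ->
  (forall x : vector, [exists w, x w] -> (0 < lev x)%N) ->
  (forall x y : vector, [exists w, x w] -> subv x y -> (lev x <= lev y)%N) ->
  (forall x y : vector, [exists w, x w] -> subv x y -> lev x = lev y -> s x != s y ->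
    (#|[set w | y w]| <= lev y)%N) ->
  exists2 x : vector, forall w, x w & (#|W| <= lev x)%N.
Proof.
move=> seq lev0 levS levD.
have nz a l : [exists w, vector_of (a :: l) w].
  by apply/existsP; exists a.1; rewrite ffunE /= eqxx.
have [|l [q [lE fl sq]]] := @fan_flag k W (s \o vector_of) _ (enum W).
  by move=> a l; rewrite /= (vector_of_shift (a :: l)) seq.
have ul : uniq [seq a.1 | a <- l] by rewrite lE enum_uniq.
exists (vector_of l) => [w|]; first by rewrite ffunE lookup_some lE mem_enum.
rewrite cardE -lE size_map.
elim: fl ul sq {lE} => [//|l1 a l2 q' fl' IH ul /= sq].
have ul' : uniq [seq b.1 | b <- l1 ++ l2].
  apply: subseq_uniq ul; apply: map_subseq; apply: cat_subseq => //.
  exact: subseq_cons.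
have nx : [exists w, vector_of (l1 ++ a :: l2) w].
  by case: (l1) => [|b l1']; apply: nz.
have {IH} := IH ul' (path_sorted sq).
have sub : subv (vector_of (l1 ++ l2)) (vector_of (l1 ++ a :: l2)).
  apply/subvP => w j; rewrite !ffunE => /eqP; rewrite lookupE // => wj.
  apply/eqP; rewrite lookupE //; move: wj; rewrite !mem_cat inE.
  by case/orP=> ->; rewrite ?orbT.
rewrite [size (l1 ++ a :: l2)]size_cat /= addnS -size_cat.
inversion fl' as [e eq|m1 b m2 q2 fl2 e eq].
  by move=> _; apply: lev0.
rewrite -{}eq /= e in sq *; case/andP: sq => sd _ IH.
have ny : [exists w, vector_of (l1 ++ l2) w].
  by rewrite -e; case: (m1) => [|c m1']; apply: nz.
rewrite ltnNge; apply/negP => le.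
have eq : lev (vector_of (l1 ++ l2)) = lev (vector_of (l1 ++ a :: l2)).
  by apply/eqP; rewrite eqn_leq levS //=; apply: leq_trans IH.
have := levD _ _ ny sub eq; rewrite eq_sym sd => /(_ isT).
rewrite card_vector_of // size_cat /= addnS -size_cat => lt.
by have := leq_ltn_trans le lt; rewrite ltnn.
Qed.

End Levels.

(** * Alternation of sign vectors along a list *)

Section SignVectors.
Variables (G V : finType).
Implicit Types (s : seq V) (E : {set {set V}}) (x y w : {ffun V -> option G}).

Definition part (j : G) x : {set V} := [set v | x v == Some j].

Definition avoids E x : bool := [forall e in E, [forall j, ~~ (e \subset part j x)]].

Definition altv s x : bool := sorted (fun i j => i != j) (pmap x s).

(* With [s] an enumeration of the vertices realizing the alternation number, this
   reads [alt E + (#|G| - 1) * C < size s]. *)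
Definition deficient C s E : bool :=
  [forall x, altv s x && avoids E x ==> (size (pmap x s) + #|G|.-1 * C < size s)].

Lemma part_sub j x y : subv x y -> part j x \subset part j y.
Proof.
move=> /subvP xy; apply/subsetP => v; rewrite !inE => /eqP xv.
by rewrite (xy _ _ xv).
Qed.

Lemma subv_trans x y w : subv x y -> subv y w -> subv x w.
Proof. by move=> /subvP xy /subvP yw; apply/subvP => v j /xy /yw. Qed.

Lemma disjoint_parts i j x : i != j -> [disjoint part i x & part j x].
Proof.
move=> ij; rewrite disjoint_subset; apply/subsetP => v; rewrite !inE => /eqP->.
by apply: contraNN ij => /eqP[->].
Qed.

Lemma altv_cons v s x : altv (v :: s) x -> altv s x.
Proof. by rewrite /altv /=; case: (x v) => //= j /path_sorted. Qed.

(** Alternating subsequences are encoded as alternating subvectors, so that monotonicity in [x] is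
    transitivity of [subv]. *)
Definition altn s x : nat := \max_(y | subv y x && altv s y) size (pmap y s).

Lemma altn_attained s x : exists y, [/\ subv y x, altv s y & altn s x = size (pmap y s)].
Proof.
have sub0 : subv [ffun=> None] x by apply/subvP => v j; rewrite ffunE.
have alt0 : altv s [ffun=> None].
  by rewrite /altv (_ : pmap _ s = [::]) //; elim: s => //= v s ->; rewrite ffunE.
have [|y /andP[sy ay] e] := @eq_bigmax_cond _ [pred y | subv y x && altv s y]
  (fun y => size (pmap y s)).
  by apply/card_gt0P; exists [ffun=> None]; rewrite inE sub0.
by exists y; split => //; rewrite -e.
Qed.

Lemma altn_ge s x y : subv y x -> altv s y -> size (pmap y s) <= altn s x.
Proof.
move=> yx ay; apply: (@leq_bigmax_cond _ _ (fun y => size (pmap y s))).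
by rewrite yx.
Qed.

Lemma altn_sub s x y : subv x y -> altn s x <= altn s y.
Proof.
move=> xy; have [w [wx aw ->]] := altn_attained s x.
by apply: altn_ge aw; apply: subv_trans xy.
Qed.

(* A longest alternating subvector cannot miss the first sign, for otherwise that
   sign could be prepended to it. *)
Lemma ohead_altv s x w :
  uniq s -> subv w x -> altv s w -> altn s x = size (pmap w s) ->
  ohead (pmap w s) = ohead (pmap x s).
Proof.
move=> us wx aw xw.
have {xw} wmax y : subv y x -> altv s y -> size (pmap y s) <= size (pmap w s).
  by rewrite -xw; apply: altn_ge.
elim: s us aw wmax => [//|v s IH] /= /andP[vs us] aw wmax.
have sw := subvP _ _ wx v.
case xv: (x v) sw wmax => [j|] sw wmax.
  case wv: (w v) sw wmax => [i|] sw wmax; first by rewrite -(sw i).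
  rewrite /=; case hw: (ohead (pmap w s) == Some j); first exact/eqP.
  pose y := [ffun u => if u == v then Some j else w u] : {ffun V -> option G}.
  have yE : pmap y s = pmap w s.
    elim: (s) vs => //= u s' IHs; rewrite inE negb_or => /andP[uv /IHs->].
    by rewrite ffunE eq_sym (negbTE uv).
  have yx : subv y x.
    apply/subvP => u i; rewrite ffunE; case: eqP => [->|_]; first by rewrite xv.
    exact: (subvP _ _ wx).
  have ay : altv (v :: s) y.
    move: (altv_cons aw); rewrite /altv /= !ffunE eqxx /= yE.
    case: (pmap w s) hw => //= i q hw ->; rewrite andbT.
    by apply: contraFN hw => /eqP->.
  by have := wmax y yx ay; rewrite /= !ffunE eqxx /= yE ltnn.
have wv : w v = None by case: (w v) sw => // i /(_ i erefl).
rewrite wv /=; apply: IH => //; first exact: altv_cons aw.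
move=> y yx ay; have := wmax y yx; rewrite /altv /= wv /=.
have -> : y v = None by case yv: (y v) => [i|//]; rewrite (subvP _ _ yx _ _ yv) in xv.
exact.
Qed.

(** A longest alternating subvector of [x] is also longest for [y], and its first sign is that of
    both. *)
Lemma ohead_altn s x y : uniq s -> subv x y -> altn s x = altn s y ->
  ohead (pmap x s) = ohead (pmap y s).
Proof.
move=> us xy e; have [w [wx aw xw]] := altn_attained s x.
rewrite -(ohead_altv us wx aw xw); apply: ohead_altv => //; last by rewrite -e.
exact: subv_trans xy.
Qed.

Lemma altn_eq0 s x : uniq s -> altn s x = 0 -> pmap x s = [::].
Proof.
move=> us e; have [w [wx aw xw]] := altn_attained s x.
have := ohead_altv us wx aw xw; rewrite e in xw.
by rewrite (size0nil (esym xw)); case: (pmap x s).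
Qed.

Lemma pmap_eq_nil s x v : pmap x s = [::] -> v \in s -> x v = None.
Proof.
elim: s => //= u s IH; case xu: (x u) => [//|] /= e.
by rewrite inE => /orP[/eqP->//|]; apply: IH.
Qed.

Lemma avoids_sub E x y : subv x y -> avoids E y -> avoids E x.
Proof.
move=> xy /forall_inP a; apply/forall_inP => e eE; apply/forallP => j.
by apply: contraNN (forallP (a e eE) j) => /subset_trans; apply; apply: part_sub.
Qed.

Lemma deficient_altn C s E x :
  deficient C s E -> avoids E x -> altn s x + #|G|.-1 * C < size s.
Proof.
move=> /forallP g a; have [w [wx aw ->]] := altn_attained s x.
by apply: (implyP (g w)); rewrite aw; apply: avoids_sub a.
Qed.

Lemma deficient_size C s E : set0 \notin E -> deficient C s E -> #|G|.-1 * C < size s.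
Proof.
move=> e0 g; apply: leq_ltn_trans (deficient_altn (x := [ffun=> None]) g _).
  exact: leq_addl.
apply/forall_inP => e eE; apply/forallP => j; apply: contraNN e0 => ej.
suff <- : e = set0 by [].
apply/eqP; rewrite -subset0; apply: subset_trans ej _.
by apply/subsetP => v; rewrite !inE ffunE.
Qed.

End SignVectors.

(** * Levels and equivariant signs in one coordinate *)

Section PrimeSigns.
Local Open Scope ring_scope.
Variable p : nat.
Hypothesis p_prime : prime p.
Local Notation F := 'F_p.

Definition average (A : {set F}) : F := (\sum_(a in A) a) / #|A|%:R.

(** Translation by 1 adds [#|A|] to the sum, and [#|A|] is invertible modulo [p] for a nonempty
    proper subset. *)
Lemma average_translate (A B : {set F}) : (0 < #|A| < p)%N ->
  (forall j, (j \in B) = (j - 1 \in A)) -> average B = average A + 1.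
Proof.
move=> /andP[A0 Ap] AB.
have -> : B = [set a + 1 | a in A].
  apply/setP => j; rewrite AB; apply/idP/imsetP => [jA|[a aA ->]].
    by exists (j - 1); rewrite ?subrK.
  by rewrite addrK.
have inj1 : injective (fun a : F => a + 1) by apply: addIr.
rewrite /average card_imset // big_imset /=; last by move=> ? ? _ _ /inj1.
rewrite big_split /= sumr_const mulrDl divff //.
apply/eqP => /(congr1 val) /=; rewrite val_Fp_nat // modn_small //.
by move=> e; rewrite e in A0.
Qed.

Variables (V : finType) (s : seq V) (E : {set {set V}}) (C : nat).
Hypotheses (us : uniq s) (C0 : (0 < C)%N) (E0 : set0 \notin E).
Hypothesis defE : deficient F C s E.
Implicit Types x y : {ffun V -> option F}.

Definition signs x : {set F} := [set j | [exists e in E, e \subset part j x]].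

(** The largest alternation number that [deficient] allows when no part contains an edge. *)
Definition base_level : nat := size s - p.-1 * C - 1.

(* Ranges over [0 .. base_level + p]: [0] for vectors vanishing on [s], the top
   value for those whose every part contains an edge.  Only the values in
   between carry a sign. *)
Definition level x : nat :=
  if signs x == set0 then altn s x else (base_level + #|signs x|)%N.

Definition sign_of x : F :=
  if signs x == set0 then head 0 (pmap x s) else average (signs x).

Lemma signs_sub x y : subv x y -> signs x \subset signs y.
Proof.
move=> xy; apply/subsetP => j; rewrite !inE => /exists_inP[e eE ex].
by apply/exists_inP; exists e => //; apply: subset_trans ex (part_sub _ xy).
Qed.

Lemma part_translate (c j : F) x : part j (translate c x) = part (j - c) x.
Proof.
apply/setP => v; rewrite !inE ffunE; case: (x v) => //= i.
by apply/eqP/eqP => -[] => [<-|->]; rewrite ?addrK ?subrK.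
Qed.

Lemma signs_translate (c j : F) x : (j \in signs (translate c x)) = (j - c \in signs x).
Proof. by rewrite !inE part_translate. Qed.

Lemma card_signs_translate (c : F) x : #|signs (translate c x)| = #|signs x|.
Proof.
rewrite -[RHS](card_imset _ (addIr c)); apply: eq_card => j; rewrite signs_translate.
apply/idP/imsetP => [jx|[i ix ->]]; last by rewrite addrK.
by exists (j - c); rewrite ?subrK.
Qed.

Lemma pmap_translate (c : F) x : pmap (translate c x) s = [seq z + c | z <- pmap x s].
Proof. by elim: s => //= v q ->; rewrite ffunE; case: (x v). Qed.

Lemma altv_translate (c : F) x : altv s (translate c x) = altv s x.
Proof.
rewrite /altv pmap_translate sorted_map; apply: eq_sorted => i j /=.
by rewrite (inj_eq (addIr _)).
Qed.

Lemma translateK (c : F) x : translate (- c) (translate c x) = x.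
Proof. by apply/ffunP => v; rewrite !ffunE; case: (x v) => //= i; rewrite addrK. Qed.

Lemma subv_translate (c : F) x y : subv x y -> subv (translate c x) (translate c y).
Proof.
move=> /subvP xy; apply/subvP => v j; rewrite !ffunE.
by case xv: (x v) => [i|//] /= [<-]; rewrite (xy _ _ xv).
Qed.

Lemma altn_translate_le (c : F) x : (altn s x <= altn s (translate c x))%N.
Proof.
have [y [yx ay ->]] := altn_attained s x.
rewrite -(size_map (fun z => z + c)) -pmap_translate; apply: altn_ge.
  exact: subv_translate.
by rewrite altv_translate.
Qed.

Lemma altn_translate (c : F) x : altn s (translate c x) = altn s x.
Proof.
apply/eqP; rewrite eqn_leq altn_translate_le andbT.
by rewrite -{2}(translateK c x) altn_translate_le.
Qed.

Lemma level_translate (c : F) x : level (translate c x) = level x.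
Proof. by rewrite /level -!cards_eq0 card_signs_translate altn_translate. Qed.

Lemma avoids_signs x : signs x = set0 -> avoids E x.
Proof.
move=> x0; apply/forall_inP => e eE; apply/forallP => j; apply/negP => ej.
have : j \in signs x by rewrite inE; apply/exists_inP; exists e.
by rewrite x0 inE.
Qed.

Lemma base_levelE : (base_level + p.-1 * C + 1 = size s)%N.
Proof.
have := deficient_size E0 defE; rewrite card_Fp // => lt.
by rewrite /base_level addnAC subnK ?subnK // ?subn_gt0 // ltnW.
Qed.

Lemma altn_le_base x : signs x = set0 -> (altn s x <= base_level)%N.
Proof.
move=> /avoids_signs /(deficient_altn defE); rewrite card_Fp //.
by rewrite -base_levelE addn1 ltnS leq_add2r.
Qed.

Lemma level_sub x y : subv x y -> (level x <= level y)%N.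
Proof.
move=> xy; have sxy := signs_sub xy; rewrite /level.
have [x0|x0] := eqVneq (signs x) set0.
  have [_|y0] := eqVneq (signs y) set0; first exact: altn_sub.
  by apply: leq_trans (altn_le_base x0) _; apply: leq_addr.
rewrite ifF ?leq_add2l ?subset_leq_card //.
by apply: contraNF x0 => /eqP y0; rewrite y0 subset0 in sxy.
Qed.

Lemma card_signs_le x : (#|signs x| <= p)%N.
Proof. by rewrite -[X in (_ <= X)%N](card_Fp p_prime) max_card. Qed.

Lemma level_le x : (level x <= base_level + p)%N.
Proof.
rewrite /level; case: eqP => [x0|_]; last by rewrite leq_add2l card_signs_le.
by apply: leq_trans (altn_le_base x0) _; apply: leq_addr.
Qed.

Lemma level_top x j : level x = (base_level + p)%N -> j \in signs x.
Proof.
rewrite /level; case: eqP => [x0 e|_ /addnI sx].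
  have := altn_le_base x0; rewrite e -{2}[base_level]addn0 leq_add2l leqNgt.
  by rewrite prime_gt0.
suff -> : signs x = setT by rewrite inE.
by apply/eqP; rewrite eqEcard subsetT cardsT card_Fp // sx leqnn.
Qed.

Lemma level_eq0 x v : level x = 0%N -> v \in s -> x v = None.
Proof.
rewrite /level; case: eqP => [_ /(altn_eq0 us) e|/eqP + /eqP].
  exact: pmap_eq_nil.
by rewrite -cards_eq0 addn_eq0 => /negbTE->; rewrite andbF.
Qed.

Lemma top_le_size : (base_level + p <= size s)%N.
Proof.
rewrite -base_levelE -addnA leq_add2l addn1 -{1}(prednK (prime_gt0 p_prime)) ltnS.
by rewrite leq_pmulr.
Qed.

(** Up to [base_level], equal levels fix the first sign by [ohead_altn]; above it, nested sets of
    signs of equal size coincide. *)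
Lemma sign_of_sub x y : subv x y -> level x = level y -> sign_of x = sign_of y.
Proof.
move=> xy; have sxy := signs_sub xy; rewrite /level /sign_of.
have [x0|x0] := eqVneq (signs x) set0.
  have [_|y0] := eqVneq (signs y) set0 => e.
    by have := ohead_altn us xy e; case: (pmap x s) (pmap y s) => [|? ?] [|? ?] //= [].
  have := altn_le_base x0; rewrite e -{2}[base_level]addn0 leq_add2l leqn0.
  by rewrite cards_eq0 (negbTE y0).
have y0 : signs y != set0.
  by apply: contraNneq x0 => y0; rewrite y0 subset0 in sxy.
rewrite (negbTE y0) => /addnI e; congr average.
by apply/eqP; rewrite eqEcard sxy e /=.
Qed.

Lemma sign_of_translate x : (0 < level x < base_level + p)%N ->
  sign_of (translate 1 x) = sign_of x + 1.
Proof.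
rewrite /level /sign_of -!cards_eq0 card_signs_translate.
have [x0|x0] := eqVneq #|signs x| 0%N; last first.
  rewrite addn_gt0 ltn_add2l => /andP[_ xp]; apply: average_translate.
    by rewrite lt0n x0.
  by move=> j; rewrite signs_translate.
case/andP=> a0 _; rewrite pmap_translate.
case px: (pmap x s) => [|//]; have [y [yx ay yE]] := altn_attained s x.
have := ohead_altv us yx ay yE; rewrite px.
by move: a0; rewrite yE; case: (pmap y s).
Qed.

End PrimeSigns.

(* The tuples [e i] form a matching, which is more than an edge of the categorical
   product: [matching_property_prod] glues matchings, while arbitrary edges with
   the same projections could not be glued. *)
Definition matching_property (G : finType) : Prop :=
  forall (t : nat) (V : 'I_t -> finType) (s : forall l, seq (V l))
    (E : forall l, {set {set V l}}) (C : nat)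
    (c : {dffun forall l, {set V l}} -> 'I_C),
  0 < t -> (forall l, uniq (s l)) -> (forall l, set0 \notin E l) ->
  (forall l e, e \in E l -> {subset e <= s l}) ->
  (forall l, deficient G C (s l) (E l)) ->
  exists e : G -> {dffun forall l, {set V l}},
    [/\ forall j l, e j l \in E l,
        forall i j l, i != j -> [disjoint e i l & e j l]
      & forall i j, c (e i) = c (e j)].

Lemma eq_leq_sum (I : finType) (f g : I -> nat) : (forall i, f i <= g i) ->
  \sum_i f i = \sum_i g i -> f =1 g.
Proof.
move=> fg e i; apply/eqP; rewrite eqn_leq fg /= leqNgt; apply/negP => lt.
have := ltnn (\sum_i g i); rewrite -{1}e (bigD1 i) //= [X in (_ < X)](bigD1 i) //=.
by rewrite -addSn leq_add // leq_sum.
Qed.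

(** * Colourings with a prime number of signs *)

Section PrimeCase.
Local Open Scope ring_scope.
Variable p : nat.
Hypothesis p_prime : prime p.
Local Notation F := 'F_p.
Variables (t : nat) (V : 'I_t -> finType) (s : forall l, seq (V l)).
Variables (E : forall l, {set {set V l}}) (C : nat).
Variable c : {dffun forall l, {set V l}} -> 'I_C.
Hypotheses (t0 : (0 < t)%N) (us : forall l, uniq (s l)).
Hypotheses (E0 : forall l, set0 \notin E l)
  (defE : forall l, deficient F C (s l) (E l)).

Let C0 : (0 < C)%N.
Proof. exact: leq_ltn_trans (leq0n _) (ltn_ord (c [ffun=> set0])). Qed.

Definition position := {w : {l : 'I_t & V l} | tagged w \in s (tag w)}.
Local Notation vector := {ffun position -> option F}.
Implicit Types x y : vector.

Definition component l x : {ffun V l -> option F} :=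
  [ffun v => obind (fun w : position => x w) (insub (Tagged V v))].

Lemma component_sub l x y : subv x y -> subv (component l x) (component l y).
Proof.
move=> /subvP xy; apply/subvP => v j; rewrite !ffunE.
by case: insub => //= w; apply: xy.
Qed.

Lemma component_translate l (a : F) x :
  component l (translate a x) = translate a (component l x).
Proof. by apply/ffunP => v; rewrite !ffunE; case: insub => //= w; rewrite ffunE. Qed.

Lemma component_pos x (w : position) :
  component (tag (val w)) x (tagged (val w)) = x w.
Proof.
rewrite ffunE insubT /= => [|h]; first by rewrite (valP w).
by congr (x _); apply: val_inj; rewrite /=; case: (val w).
Qed.

Local Notation top l := (base_level p (s l) C + p)%N.
Local Notation lev l x := (level (s l) (E l) C (component l x)).

Let topN l : (top l + (p.-1 * C.-1 + 1) = (size (s l)).+1)%N.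
Proof.
rewrite -(base_levelE p_prime (E0 l) (defE l)).
move: (base_level _ _ _) (prime_gt0 p_prime) C0 => b.
by case: (p) => // p' _; case: (C) => // C' _ /=; rewrite mulnS; lia.
Qed.

Let top_le l : (top l <= size (s l))%N.
Proof. exact: (top_le_size p_prime C0 (E0 l) (defE l)). Qed.

Let lev_le l x : (lev l x <= top l)%N.
Proof. exact: (level_le p_prime (E0 l) (defE l)). Qed.

Let lev_sub l x y : subv x y -> (lev l x <= lev l y)%N.
Proof. by move=> xy; apply: (level_sub p_prime (E0 l) (defE l)); apply: component_sub. Qed.

Definition saturated x : bool := [forall l, lev l x == top l].

Definition color_signs (k : 'I_C) x : {set F} :=
  [set j | [exists e : {dffun forall l, {set V l}}, (c e == k) &&
    [forall l, (e l \in E l) && (e l \subset part j (component l x))]]].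

Hypothesis no_matching : forall k x, color_signs k x != setT.

Lemma color_signs_sub k x y : subv x y -> color_signs k x \subset color_signs k y.
Proof.
move=> xy; apply/subsetP => j; rewrite !inE => /existsP[e /andP[ek /forallP eE]].
apply/existsP; exists e; rewrite ek; apply/forallP => l.
have /andP[-> /subset_trans] := eE l; apply.
exact: part_sub (component_sub l xy).
Qed.

Lemma color_signs_translate k x j :
  (j \in color_signs k (translate 1 x)) = (j - 1 \in color_signs k x).
Proof.
rewrite !inE; apply: eq_existsb => e; congr (_ && _).
by apply: eq_forallb => l; rewrite component_translate part_translate.
Qed.

Lemma card_color_signs_translate k x :
  #|color_signs k (translate 1 x)| = #|color_signs k x|.
Proof.
rewrite -[RHS](card_imset _ (addIr 1)); apply: eq_card => j.
rewrite color_signs_translate.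
apply/idP/imsetP => [jx|[i ix ->]]; last by rewrite addrK.
by exists (j - 1); rewrite ?subrK.
Qed.

Lemma card_color_signs k x : (#|color_signs k x| <= p.-1)%N.
Proof.
rewrite -ltnS prednK ?prime_gt0 // -[X in (_ < X)%N](card_Fp p_prime) -cardsT.
by apply: proper_card; rewrite properT.
Qed.

Definition color_count x : nat := (\sum_k #|color_signs k x|)%N.

(** For every sign, edges in its parts over all coordinates form a tuple, and this tuple counts the
    sign for its colour. *)
Lemma color_count_ge x : saturated x -> (p <= color_count x)%N.
Proof.
move=> /forallP sat; rewrite /color_count -[X in (X <= _)%N](card_Fp p_prime) -cardsT.
have cov : [set: F] \subset \bigcup_k color_signs k x.
  apply/subsetP => j _.
  have ex l : exists e, (e \in E l) && (e \subset part j (component l x)).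
    have := level_top p_prime (E0 l) (defE l) j (eqP (sat l)).
    by rewrite inE => /exists_inP[e eE ej]; exists e; rewrite eE.
  have [e eP] := fin_all_exists ex.
  pose d : {dffun forall l, {set V l}} := [ffun l => e l].
  apply/bigcupP; exists (c d) => //; rewrite inE; apply/existsP; exists d.
  rewrite eqxx; apply/forallP => l; rewrite ffunE; apply: eP.
apply: leq_trans (subset_leq_card cov) _.
elim/big_rec2: _ => [|k a B _ h]; first by rewrite cards0.
by apply: leq_trans (leq_card_setU _ _) _; rewrite leq_add2l.
Qed.

(* What [top l] leaves free in [size (s l)], plus one. *)
Definition slack : nat := (p.-1 * C.-1 + 1)%N.

(** A component at the top level carries no sign; crediting it with all its positions makes
    [card_support_le] hold. *)
Definition capped l x : nat := if lev l x == top l then size (s l) else lev l x.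

(* By [rank_unsaturated] the saturated vectors rank above the others, and they
   contain at least [p] pairs (sign, colour) but at most [p - 1] for each colour. *)
Definition rank x : nat :=
  if saturated x then (#|{: position}| - slack + (color_count x).+1 - p)%N
  else (\sum_l capped l x)%N.

(** The last branch serves vectors whose components all have level 0 or the top level. Nonzero
    vectors reach no default 0: saturated ones have a colour with signs by [color_count_ge]. *)
Definition sign x : F :=
  if saturated x then
    if [pick k | color_signs k x != set0] is Some k then average (color_signs k x)
    else 0
  else if [pick l | (0 < lev l x < top l)%N] is Some l then
    sign_of (s l) (E l) (component l x)
  else head 0 (pmap x (enum {: position})).

Lemma card_position : #|{: position}| = (\sum_l size (s l))%N.
Proof.
rewrite card_sig -sum1_card.
rewrite (eq_bigl (fun w : {l : 'I_t & V l} => tagged w \in s (tag w))) //.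
rewrite -(sig_big_dep (fun=> true) (fun l v => v \in s l) (fun _ _ => 1%N)) /=.
by apply: eq_bigr => l _; rewrite sum1_card; apply/card_uniqP.
Qed.

Lemma saturated_sub x y : subv x y -> saturated x -> saturated y.
Proof.
move=> xy /forallP sx; apply/forallP => l; rewrite eqn_leq lev_le.
by rewrite -(eqP (sx l)) lev_sub.
Qed.

Lemma capped_le l x : (capped l x <= size (s l))%N.
Proof. by rewrite /capped; case: ifP => // _; apply: leq_trans (lev_le l x) _. Qed.

Lemma capped_sub l x y : subv x y -> (capped l x <= capped l y)%N.
Proof.
move=> xy; rewrite {2}/capped; case: ifPn => [_|yt]; first exact: capped_le.
have yl : (lev l y < top l)%N by rewrite ltn_neqAle yt lev_le.
rewrite /capped ifF ?lev_sub //.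
by apply/negbTE; rewrite neq_ltn (leq_ltn_trans (lev_sub l xy)).
Qed.

(** A component below the top has level at most [top l - 1], which is [size (s l) - slack] by
    [topN]; the others count at most in full. *)
Lemma rank_unsaturated x : ~~ saturated x ->
  (rank x <= #|{: position}| - slack)%N.
Proof.
move=> nx; rewrite /rank (negbTE nx); case/forallPn: nx => l xl.
rewrite card_position (bigD1 l) //= [X in (_ <= X - _)%N](bigD1 l) //=.
have sl : (slack <= size (s l))%N.
  by have := topN l; have := prime_gt0 p_prime; rewrite -/slack; lia.
rewrite addnC -addnBAC // addnC leq_add //.
  have : (lev l x < top l)%N by rewrite ltn_neqAle xl lev_le.
  by rewrite /capped (negbTE xl); have := topN l; rewrite -/slack; lia.
by apply: leq_sum => i _; apply: capped_le.
Qed.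

Lemma card_support_le y :
  (forall w : position, y w -> lev (tag (val w)) y = top (tag (val w))) ->
  (#|[set w | y w]| <= \sum_l capped l y)%N.
Proof.
move=> ytop; pose P l := lev l y == top l.
rewrite -(card_imset _ val_inj).
apply: (@leq_trans (\sum_(l | P l) size (s l))); last first.
  rewrite [X in (_ <= X)%N](bigID P) /=; apply: leq_trans (leq_addr _ _).
  by apply: leq_sum => l Pl; rewrite /capped ifT.
rewrite (eq_bigr (fun l => \sum_(v in s l) 1)%N) => [|l _]; last first.
  by rewrite sum1_card; apply/esym/card_uniqP.
rewrite (sig_big_dep P (fun l v => v \in s l) (fun _ _ => 1%N)) sum1_card.
apply: subset_leq_card; apply/subsetP => _ /imsetP[w + ->].
by rewrite inE => yw; apply/andP; split; [rewrite /P (ytop _ yw)|exact: (valP w)].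
Qed.

Lemma level_pos x (w : position) : x w -> (0 < lev (tag (val w)) x)%N.
Proof.
move=> xw; rewrite lt0n; apply: contraTneq xw => e; rewrite -component_pos.
by rewrite (level_eq0 (us _) e (valP w)).
Qed.

Lemma color_count_sub x y : subv x y -> (color_count x <= color_count y)%N.
Proof. by move=> xy; apply: leq_sum => k _; apply/subset_leq_card/color_signs_sub. Qed.

Lemma rank_gt0 x : [exists w, x w] -> (0 < rank x)%N.
Proof.
case/existsP=> w xw; rewrite /rank; case: ifPn => sx.
  by have := color_count_ge sx; lia.
rewrite (bigD1 (tag (val w))) //= addn_gt0 /capped.
have lw := level_pos xw; case: eqP => [e|_]; last by rewrite lw.
by rewrite (leq_trans lw) // e.
Qed.

Lemma rank_sub x y : subv x y -> (rank x <= rank y)%N.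
Proof.
move=> xy; have [sx|sx] := boolP (saturated x).
  rewrite /rank sx (saturated_sub xy sx).
  by have := color_count_sub xy; lia.
have [sy|sy] := boolP (saturated y).
  apply: leq_trans (rank_unsaturated sx) _; rewrite /rank sy.
  by have := color_count_ge sy; lia.
rewrite /rank (negbTE sx) (negbTE sy); apply: leq_sum => l _.
exact: capped_sub.
Qed.

(** Confusion would need a level below [top l] equal to [size (s l)], which [top_le] excludes. *)
Lemma capped_inj l x y : subv x y -> capped l x = capped l y -> lev l x = lev l y.
Proof.
move=> xy; rewrite /capped; case: eqP => [xt|/eqP xt].
  by move=> _; apply/eqP; rewrite eqn_leq lev_sub // xt lev_le.
case: eqP => [_ e|//]; have := top_le l; rewrite -e => le.
by move: xt; rewrite eqn_leq lev_le le.
Qed.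

(** Equal ranks put both vectors on the same side of saturation. Saturated ones have the same signs
    for each colour, hence equal sign. Otherwise all levels agree, and by [sign_of_sub] no component
    is strictly between 0 and the top; nonzero entries then lie in top components, as
    [card_support_le] requires. *)
Lemma rank_sign x y : [exists w, x w] -> subv x y -> rank x = rank y ->
  sign x != sign y -> (#|[set w | y w]| <= rank y)%N.
Proof.
move=> /existsP[w0 xw0] xy e sxy; move: e.
have [sy|sy] := boolP (saturated y).
  have [sx|sx] := boolP (saturated x); last first.
    move=> e; have := rank_unsaturated sx; rewrite e /rank sy.
    by have := color_count_ge sy; lia.
  rewrite /rank sx sy => e.
  have ec : color_count x = color_count y.
    by have := color_count_ge sx; have := color_count_ge sy; lia.
  have eqs k : color_signs k x = color_signs k y.
    apply/eqP; rewrite eqEcard color_signs_sub //=.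
    rewrite (@eq_leq_sum _ (fun k => #|color_signs k x|) (fun k => #|color_signs k y|)) //.
    by move=> i; apply/subset_leq_card/color_signs_sub.
  case/eqP: sxy; rewrite /sign sx sy.
  rewrite (@eq_pick _ _ (fun k => color_signs k y != set0)) => [|k]; last by rewrite /= eqs.
  by case: pickP => // k _; rewrite eqs.
have sx : ~~ saturated x by apply: contraNN sy; apply: saturated_sub.
rewrite /rank (negbTE sx) (negbTE sy) => e.
have el l : lev l x = lev l y.
  apply: capped_inj => //; apply: (eq_leq_sum (f := fun l => capped l x)) e l.
  by move=> i; apply: capped_sub.
apply: card_support_le => w yw.
apply/eqP; rewrite eqn_leq lev_le leqNgt; apply/negP => lt.
case/eqP: sxy; rewrite /sign (negbTE sx) (negbTE sy).
rewrite (@eq_pick _ _ (fun l => 0 < lev l y < top l)%N) => [|l]; last by rewrite /= el.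
case: pickP => [l _|/(_ (tag (val w)))]; last by rewrite (level_pos yw) lt.
exact: (sign_of_sub p_prime (us l) (E0 l) (defE l) (component_sub l xy) (el l)).
Qed.

Lemma lev_translate l (a : F) x : lev l (translate a x) = lev l x.
Proof. by rewrite component_translate level_translate. Qed.

Lemma saturated_translate (a : F) x : saturated (translate a x) = saturated x.
Proof. by apply: eq_forallb => l; rewrite lev_translate. Qed.

Lemma sign_translate x : [exists w, x w] -> sign (translate 1 x) = sign x + 1.
Proof.
move=> /existsP[w xw]; rewrite /sign saturated_translate; case: ifPn => sx.
  rewrite (@eq_pick _ _ (fun k => color_signs k x != set0)) => [|k]; last first.
    by rewrite /= -!cards_eq0 card_color_signs_translate.
  case: pickP => [k xk|x0].
    apply: average_translate => // [|j]; last exact: color_signs_translate.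
    rewrite card_gt0 xk /= -[X in (_ < X)%N]prednK ?prime_gt0 //.
    exact: card_color_signs.
  have := color_count_ge sx; rewrite /color_count big1 => [|k _].
    by rewrite leqNgt prime_gt0.
  by apply/eqP; rewrite cards_eq0; apply/negbFE/x0.
rewrite (@eq_pick _ _ (fun l => 0 < lev l x < top l)%N) => [|l]; last first.
  by rewrite /= lev_translate.
case: pickP => [l xl|_].
  by rewrite component_translate; apply: sign_of_translate xl.
rewrite (_ : pmap _ _ = [seq z + 1 | z <- pmap x (enum {: position})]).
  have: w \in enum {: position} by rewrite mem_enum.
  by case e: (pmap x _) => [|//] /(pmap_eq_nil e) xN; rewrite xN in xw.
by elim: (enum _) => //= v q ->; rewrite ffunE; case: (x v).
Qed.

(** A vector of rank at least the number of positions cannot exist: unsaturated ranks lose [slack],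
    and a saturated vector has at most [C * p.-1] pairs (sign, colour), which leaves its rank one
    short. *)
Lemma prime_case_contradiction : False.
Proof.
(* For this value of [k], ['I_k.+2] is ['F_p]. *)
have [x _ nx] := @tucker_level (Zp_trunc (pdiv p)) position sign rank
  sign_translate rank_gt0 (fun x y _ => @rank_sub x y) rank_sign.
have sp : (0 < slack)%N by rewrite /slack addn1.
have pn : (slack <= #|{: position}|)%N.
  rewrite card_position (bigD1 (Ordinal t0)) //=; apply: leq_trans (leq_addr _ _).
  have := topN (Ordinal t0); rewrite -/slack; have := prime_gt0 p_prime; lia.
have ltN : (#|{: position}| - slack < #|{: position}|)%N.
  by rewrite ltn_subrL sp (leq_trans sp pn).
have [sx|sx] := boolP (saturated x); last first.
  by have := leq_ltn_trans (leq_trans nx (rank_unsaturated sx)) ltN; rewrite ltnn.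
have cx : (color_count x <= C * p.-1)%N.
  apply: leq_trans (leq_sum _ (fun k _ => card_color_signs k x)) _.
  by rewrite sum_nat_const card_ord.
have e : (C * p.-1 + 1 = slack + p.-1)%N.
  by rewrite /slack -{1}(prednK C0) mulSn mulnC; lia.
have : (rank x < #|{: position}|)%N.
  rewrite /rank sx; apply: (@leq_ltn_trans (#|{: position}| - 1)).
    by move: pn sp ltN; move: #|_| => N; have := prime_gt0 p_prime; lia.
  by rewrite ltn_subrL /= (leq_trans sp pn).
by rewrite ltnNge nx.
Qed.

End PrimeCase.

(** A colour that occurs with every sign yields one tuple per sign, disjoint because distinct parts
    are. *)
Lemma matching_property_prime (p : nat) : prime p -> matching_property 'F_p.
Proof.
move=> p_prime t V s E C c t0 us E0 _ defE.
have [/existsP[k /existsP[x /eqP kx]]|nm] :=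
  boolP [exists k, [exists x : {ffun position s -> option 'F_p},
    color_signs E c k x == setT]]; last first.
  case: (@prime_case_contradiction p p_prime t V s E C c t0 us E0 defE) => k x.
  by move: nm; rewrite negb_exists => /forallP/(_ k); rewrite negb_exists => /forallP.
have ex j : exists e : {dffun forall l, {set V l}}, (c e == k) &&
    [forall l, (e l \in E l) && (e l \subset part j (component l x))].
  by apply/existsP; have := in_setT j; rewrite -kx inE.
have [e eP] := fin_all_exists ex.
have {}eP j : c (e j) = k /\
    forall l, (e j l \in E l) && (e j l \subset part j (component l x)).
  by have /andP[/eqP ek /forallP] := eP j.
exists e; split=> [j l|i j l ij|i j].
- by have [_ /(_ l)/andP[]] := eP j.
- have [_ /(_ l)/andP[_ ei]] := eP i; have [_ /(_ l)/andP[_ ej]] := eP j.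
  apply: disjointWl ei _; apply: disjointWr ej _.
  exact: disjoint_parts.
by have [-> _] := eP i; have [-> _] := eP j.
Qed.

(** * Multiplicativity in the number of signs *)

Section Products.
Variables G1 G2 : finType.
Hypotheses (G1_gt0 : 0 < #|G1|) (G2_gt0 : 0 < #|G2|).

Definition induced (V : finType) (E : {set {set V}}) (A : {set V}) :=
  [set e in E | e \subset A].

Definition deficient_subsets C (V : finType) (s : seq V) (E : {set {set V}}) :
    {set {set V}} :=
  [set A : {set V} | (A \subset [set v in s]) &&
    deficient G2 C [seq v <- s | v \in A] (induced E A)].

Lemma sorted_components (q : seq (G1 * G2)) :
  (forall i, sorted (fun a b => a != b) [seq b.2 | b <- q & b.1 == i]) ->
  sorted (fun a b => a != b) q.
Proof.
elim: q => //= -[i j] q IH h.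
have {}IH : sorted (fun a b => a != b) q.
  by apply: IH => k; have := h k; case: ifP => //= _ /path_sorted.
case: q h IH => //= -[i' j'] q h ->; rewrite andbT.
apply: contraTneq (h i) => -[<- <-].
by rewrite /= eqxx /= eqxx.
Qed.

Lemma size_components (q : seq (G1 * G2)) :
  size q = \sum_i size [seq b.2 | b <- q & b.1 == i].
Proof.
under eq_bigr do rewrite size_map size_filter.
elim: q => [|[i j] q IH] /=; first by rewrite big1.
by rewrite big_split /= -IH (bigD1 i) //= eqxx big1 // => k /negbTE; rewrite eq_sym => ->.
Qed.

Lemma size_pmap_parts (V : finType) (s : seq V) (x : {ffun V -> option G1}) :
  size (pmap x s) = \sum_i size [seq v <- s | x v == Some i].
Proof.
under eq_bigr do rewrite size_filter.
elim: s => [|v s IH] /=; first by rewrite big1.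
rewrite big_split /= -IH; case: (x v) => [i|] /=; last by rewrite big1.
by rewrite (bigD1 i) //= eqxx big1 // => k /negbTE ki;
  rewrite -[Some i == Some k]/(i == k) eq_sym ki.
Qed.

(* Sign vectors of the parts of [x] combine with [x] into a sign vector over
   [G1 * G2], which alternates as soon as each of its components does. *)
Lemma deficient_prod C (V : finType) (s : seq V) (E : {set {set V}}) :
  (forall e, e \in E -> {subset e <= s}) ->
  deficient (G1 * G2)%type C s E -> deficient G1 C s (deficient_subsets C s E).
Proof.
move=> Es defE; apply/forallP => x; apply/implyP => /andP[_ avx].
rewrite ltnNge; apply/negP => le.
pose A i := part i x :&: [set v in s].
have fA i : [seq v <- s | v \in A i] = [seq v <- s | x v == Some i].
  by apply: eq_in_filter => v vs; rewrite !inE vs andbT.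
(* As [x] avoids the deficient subsets, [A i] is not one of them, and some [y] violates its
   deficiency. *)
have ex i : exists y : {ffun V -> option G2},
    [/\ altv [seq v <- s | v \in A i] y, avoids (induced E (A i)) y &
     size [seq v <- s | v \in A i] <=
       size (pmap y [seq v <- s | v \in A i]) + #|G2|.-1 * C].
  have : A i \notin deficient_subsets C s E.
    apply/negP => /(forall_inP avx)/forallP/(_ i)/negP; apply.
    exact: subsetIl.
  rewrite inE subsetIr /= => /forallPn[y]; rewrite negb_imply -leqNgt.
  by case/andP=> /andP[ay ey] le'; exists y.
have [y yP] := fin_all_exists ex.
pose z : {ffun V -> option (G1 * G2)} :=
  [ffun v => obind (fun i => omap (pair i) (y i v)) (x v)].
have zE i q : [seq b.2 | b <- pmap z q & b.1 == i] =
    pmap (y i) [seq v <- q | x v == Some i].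
  elim: q => //= v q IH; rewrite ffunE; case: (x v) => [k|] //=.
  have -> : (Some k == Some i) = (k == i) by [].
  case: eqP => [->|ki] /=; first by case: (y i v) => [j|] //=; rewrite eqxx /= IH.
  by case: (y k v) => [j|] //=; rewrite ifF //; apply/eqP.
have az : altv s z.
  apply: sorted_components => i; rewrite zE -fA.
  by have [] := yP i.
have avz : avoids E z.
  apply/forall_inP => e eE; apply/forallP => -[i j]; apply/negP => /subsetP ez.
  have zij v : v \in e -> x v = Some i /\ y i v = Some j.
    move/ez; rewrite inE ffunE; case: (x v) => //= k; case yk: (y k v) => [h|//] /=.
    by case/eqP=> <- <-.
  have [_ ay _] := yP i.
  have eA : e \in induced E (A i).
    rewrite inE eE; apply/subsetP => v ve; rewrite !inE.
    by have [-> _] := zij v ve; rewrite eqxx (Es e eE).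
  have /negP := forallP (forall_inP ay e eA) j; apply; apply/subsetP => v ve.
  by rewrite inE; have [_ ->] := zij v ve.
have := implyP (forallP defE z); rewrite az avz => /(_ isT).
rewrite ltnNge => /negP; apply; apply: leq_trans le _.
rewrite card_prod size_pmap_parts size_components.
apply: (@leq_trans (\sum_i
  (size [seq b.2 | b <- pmap z s & b.1 == i] + #|G2|.-1 * C) + #|G1|.-1 * C)).
  rewrite leq_add2r; apply: leq_sum => i _; rewrite zE -fA.
  by have [] := yP i.
rewrite big_split /= sum_nat_const -addnA leq_add2l.
(* Here [#|G1| * #|G2| - 1] splits as [#|G1| * (#|G2| - 1) + (#|G1| - 1)]. *)
case: #|G1| G1_gt0 => // r1 _; case: #|G2| G2_gt0 => // r2 _ /=.
by rewrite !mulSn !mulnS; nia.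
Qed.

Lemma matching_property_prod :
  matching_property G1 -> matching_property G2 ->
  matching_property (G1 * G2)%type.
Proof.
move=> M1 M2 t V s E C c t0 us E0 Es defE.
(* Tuples of deficient subsets are coloured by [d] with the colour of some [G2]-matching inside
   them; the default [c A] concerns only tuples without such a matching. *)
pose mono (A : {dffun forall l, {set V l}}) k :=
  [exists e : {ffun G2 -> {dffun forall l, {set V l}}},
    [forall j, (c (e j) == k) && [forall l, e j l \in induced (E l) (A l)]] &&
    [forall i, [forall j, (i != j) ==> [forall l, [disjoint e i l & e j l]]]]].
pose d A := odflt (c A) [pick k | mono A k].
have dP (A : {dffun forall l, {set V l}}) :
    (forall l, A l \in deficient_subsets C (s l) (E l)) -> mono A (d A).
  move=> AT; suff [k kA] : exists k, mono A k.
    by rewrite /d; case: pickP => //= /(_ k); rewrite kA.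
  have [||||e [eE ed ec]] := M2 t V (fun l => [seq v <- s l | v \in A l])
    (fun l => induced (E l) (A l)) C c t0.
  - by move=> l; rewrite filter_uniq.
  - by move=> l; rewrite inE negb_and E0.
  - move=> l e; rewrite inE => /andP[eE /subsetP eA] v ve.
    by rewrite mem_filter eA ?(Es l e).
  - by move=> l; have := AT l; rewrite inE => /andP[].
  have [j0 _] := card_gt0P G2_gt0.
  exists (c (e j0)); apply/existsP; exists (finfun e); apply/andP; split.
    apply/forallP => j; rewrite ffunE (ec j j0) eqxx.
    by apply/forallP => l; apply: eE.
  apply/forallP => i; apply/forallP => j; apply/implyP => ij; apply/forallP => l.
  by rewrite !ffunE ed.
have [|||A [AT Ad Ac]] := M1 t V s (fun l => deficient_subsets C (s l) (E l)) C d t0 us.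
- move=> l; rewrite inE sub0set /=; apply/negP => /deficient_size.
  rewrite (eq_filter (a2 := pred0)) ?filter_pred0 => [|v]; last by rewrite inE.
  by rewrite inE negb_and E0 => /(_ isT).
- by move=> l B; rewrite inE => /andP[/subsetP Bs _] v /Bs; rewrite inE.
- by move=> l; apply: deficient_prod (Es l) (defE l).
have ex i : exists e : {ffun G2 -> {dffun forall l, {set V l}}},
    [/\ forall j, c (e j) = d (A i), forall j l, e j l \in induced (E l) (A i l) &
     forall j k l, j != k -> [disjoint e j l & e k l]].
  have /existsP[e /andP[/forallP eE /forallP ed]] := dP (A i) (AT i).
  exists e; split=> [j|j l|j k l jk].
  - by have /andP[/eqP] := eE j.
  - by have /andP[_ /forallP] := eE j.
  - by have /forallP/(_ k)/implyP/(_ jk)/forallP := ed j.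
have [e eP] := fin_all_exists ex.
exists (fun b => e b.1 b.2); split=> [[i j] l|[i j] [i' j'] l /= ne|[i j] [i' j']] /=.
- by have [_ /(_ j l) + _] := eP i; rewrite inE => /andP[].
- have [_ /(_ j l) + ed] := eP i; have [_ /(_ j' l) + _] := eP i'.
  rewrite !inE => /andP[_ e'A] /andP[_ eA].
  (* Different first signs use disjoint sets; equal ones share a [G2]-matching. *)
  have [ii|ii] := eqVneq i i'; last first.
    by apply: disjointWl eA _; apply: disjointWr e'A _; apply: Ad.
  by rewrite -ii; apply: ed; apply: contraNneq ne => ->; rewrite ii.
- by have [-> _ _] := eP i; have [-> _ _] := eP i'; apply: Ac.
Qed.

End Products.

(** * Extension to every set of at least two signs *)

Lemma deficient_bij (G G' V : finType) (f : G -> G') C (s : seq V)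
    (E : {set {set V}}) :
  bijective f -> deficient G' C s E -> deficient G C s E.
Proof.
move=> bf; have [g fK gK] := bf; rewrite /deficient => /forallP h.
rewrite (bij_eq_card bf); apply/forallP => x; apply/implyP => /andP[ax ex].
pose y := [ffun v => omap f (x v)].
have yE : pmap y s = map f (pmap x s).
  by elim: (s) => //= v q ->; rewrite ffunE; case: (x v).
have := implyP (h y); rewrite yE size_map; apply; apply/andP; split.
  rewrite /altv yE sorted_map; apply: sub_sorted ax => i j /=.
  by rewrite (bij_eq bf).
apply/forall_inP => e eE; apply/forallP => j.
apply: contraNN (forallP (forall_inP ex e eE) (g j)) => /subsetP ey.
apply/subsetP => v /ey; rewrite !inE ffunE; case: (x v) => //= i /eqP[<-].
by rewrite fK.
Qed.

Lemma matching_property_card (G G' : finType) :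
  #|G| = #|G'| -> matching_property G -> matching_property G'.
Proof.
move=> e M t V s E C c t0 us E0 Es defE.
have bf : bijective (fun i : G => enum_val (cast_ord e (enum_rank i))).
  exists (fun j => enum_val (cast_ord (esym e) (enum_rank j))) => i.
    by rewrite enum_valK cast_ordK enum_rankK.
  by rewrite enum_valK cast_ordKV enum_rankK.
have [h [hE hd hc]] := M t V s E C c t0 us E0 Es (fun l => deficient_bij bf (defE l)).
have [g fK gK] := bf.
exists (fun j => h (g j)); split=> [j l|i j l ij|i j] //.
by apply: hd; apply: contraNneq ij => gij; rewrite -(gK i) gij gK.
Qed.

(** Induction splits off the least prime factor of [#|G|]. *)
Lemma matching_property_all (G : finType) : 1 < #|G| -> matching_property G.
Proof.
have [n] := ubnP #|G|; elim: n G => // n IH G ltG G1.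
have pp := pdiv_prime G1; set p := pdiv #|G| in pp.
have pG : #|G| = p * (#|G| %/ p) by rewrite mulnC divnK // pdiv_dvd.
have Mp := matching_property_prime pp.
have [q1|q1] := leqP (#|G| %/ p) 1.
  apply: matching_property_card Mp; rewrite card_Fp // [RHS]pG.
  by case: (_ %/ _) q1 pG => [|[|//]] _ pG; move: G1; rewrite pG ?muln0 ?muln1.
apply: (@matching_property_card ('F_p * 'I_(#|G| %/ p))%type).
  by rewrite card_prod card_Fp // card_ord.
apply: matching_property_prod => //.
- by rewrite card_Fp // prime_gt0.
- by rewrite card_ord ltnW.
apply: IH; rewrite card_ord //; apply: leq_trans (_ : #|G| <= n) => //.
by rewrite ltn_Pdiv ?prime_gt1 // ltnW.
Qed.

(** * From alternation numbers to the chromatic number *)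

Lemma max_alternating_ge (r : nat) (q : seq 'I_r) :
  alternating q -> size q <= max_alternating q.
Proof.
move=> aq; pose m : (size q).-tuple bool := [tuple of nseq (size q) true].
have mq : mask m q = q by rewrite /m /= mask_true.
rewrite -{1}mq; apply: (@leq_bigmax_cond _ _
  (fun m : (size q).-tuple bool => size (mask m q))).
by rewrite mq.
Qed.

Lemma deficient_of_alt (r C : nat) (H : hypergraph) :
  alt r H + r.-1 * C < #|vertex H| ->
  exists s : seq (vertex H),
    [/\ uniq s, forall v, v \in s & deficient 'I_r C s (edges H)].
Proof.
rewrite /alt; set f := (X in min_over X).
have [pi ->] := min_over_attained f (perm_one _); rewrite {}/f.
move=> lt; exists [seq pi v | v <- enum (vertex H)]; split.
- by rewrite map_inj_uniq ?enum_uniq //; apply: perm_inj.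
- by move=> v; rewrite -[v](permKV pi) map_f ?mem_enum.
apply/forallP => x; apply/implyP => /andP[ax ex].
rewrite size_map -cardE card_ord; apply: leq_ltn_trans lt; rewrite leq_add2r.
have pE : pmap x [seq pi v | v <- enum (vertex H)] =
    pmap id [seq x (pi v) | v <- enum (vertex H)].
  by elim: (enum _) => //= v q ->.
rewrite /altv pE in ax; rewrite pE; apply: leq_trans (max_alternating_ge ax) _.
apply: (@leq_bigmax_cond _ _ (fun x : sign_vector r _ => alt_perm pi x)).
apply/forallP => j; apply/eqP/setP => e; rewrite !inE.
apply/negbTE; rewrite negb_and -implybE; apply/implyP => eE.
exact: forallP (forall_inP ex e eE) j.
Qed.

Lemma alternating_full (G V : finType) (s : seq V) : 1 < #|G| -> uniq s ->
  exists x : {ffun V -> option G}, altv s x /\ size (pmap x s) = size s.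
Proof.
move=> /card_gt1P[i [j [_ _ ij]]]; elim: s => [|v s IH] /=.
  by move=> _; exists [ffun=> None].
case/andP=> vs /IH[x [ax sx]].
pose k := if ohead (pmap x s) == Some i then j else i.
pose y := [ffun u => if u == v then Some k else x u].
have yE : pmap y s = pmap x s.
  elim: (s) vs => //= u q IHq; rewrite inE negb_or => /andP[uv /IHq->].
  by rewrite ffunE eq_sym (negbTE uv).
exists y; rewrite /altv /= ffunE eqxx /= yE sx; split=> //.
move: ax; rewrite /altv /k; case: (pmap x s) => //= a q ->; rewrite andbT.
rewrite -[Some a == Some i]/(a == i).
by have [->|ai] := eqVneq a i; rewrite eq_sym.
Qed.

(** Without edges, a fully alternating vector would violate the deficiency. *)
Lemma deficient_edge (G V : finType) (s : seq V) (E : {set {set V}}) C :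
  1 < #|G| -> uniq s -> deficient G C s E -> exists e, e \in E.
Proof.
move=> G1 us defE; have [x [ax sx]] := alternating_full G1 us.
apply/set0Pn; apply/negP => /eqP E0; have := implyP (forallP defE x).
rewrite ax sx (_ : avoids E x) => [/(_ isT)|]; first by rewrite ltnNge leq_addr.
by apply/forall_inP => e; rewrite E0 inE.
Qed.

(** If the bound failed, every [H l] would be deficient for [chi P] colours, and a matching over
    ['I_r] would be a monochromatic edge of the product. *)
Lemma min_le_chi (r t : nat) (H : 'I_t -> hypergraph) :
  2 <= r -> 1 <= t -> (forall l, set0 \notin edges (H l)) ->
  min_over (fun l => #|vertex (H l)| - alt r (H l)) <=
    r.-1 * chi (cat_prod (fun l => KG r (H l))).
Proof.
move=> r2 t1 H0; rewrite leqNgt; apply/negP => lt.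
set P := cat_prod _ in lt.
(* Since [r >= 2], edges of the product have at least two vertices, so [chi P] is attained by a
   proper colouring. *)
have [/colorableP[c /forall_inP cP] _] := chi_min (cat_prod_KG_colorable H r2 t1).
have ex l : exists s : seq (vertex (H l)),
    [/\ uniq s, forall v, v \in s & deficient 'I_r (chi P) s (edges (H l))].
  apply: deficient_of_alt; rewrite -ltn_subRL.
  by apply: leq_trans lt _; apply: min_over_le.
have [s sP] := fin_all_exists ex.
have G1 : 1 < #|'I_r| by rewrite card_ord.
have ex0 l : exists e, e \in edges (H l).
  by have [us _ ds] := sP l; apply: deficient_edge G1 us ds.
(* Only a default for [insubd]; tuples of edges never use it, by [ptE]. *)
pose e0 l : vertex (KG r (H l)) :=
  exist (fun e => e \in edges (H l)) _ (xchooseP (ex0 l)).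
pose pt (e : {dffun forall l, {set vertex (H l)}}) : vertex P :=
  [ffun l => insubd (e0 l) (e l)].
have [||||e [eE ed ec]] := matching_property_all G1
  (V := fun l => vertex (H l)) (s := s) (E := fun l => edges (H l))
  (fun e => c (pt e)) t1.
- by move=> l; have [] := sP l.
- exact: H0.
- by move=> l f _ v _; have [_ ->] := sP l.
- by move=> l; have [] := sP l.
have ptE j l : val (pt (e j) l) = e j l by rewrite ffunE insubdK //; apply: eE.
pose F : {set vertex P} := [set pt (e j) | j : 'I_r].
have FP : F \in edges P.
  rewrite inE; apply/forallP => l.
  have -> : [set x l | x : vertex P in F] = [set pt (e j) l | j : 'I_r].
    by rewrite -imset_comp.
  (* Disjoint nonempty edges differ, so each projection has exactly [r] elements. *)
  rewrite inE card_imset ?card_ord ?eqxx /= => [|i j /(congr1 val)]; last first.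
    rewrite !ptE => eij; apply/eqP/negPn/negP => /(ed _ _ l).
    rewrite eij -setI_eq0 setIid => /eqP ej.
    by have := eE j l; rewrite ej (negbTE (H0 l)).
  apply/forall_inP => _ /imsetP[i _ ->]; apply/forall_inP => _ /imsetP[j _ ->].
  apply/implyP => ij; rewrite !ptE; apply: ed.
  by apply: contraNneq ij => ->.
have /exists_inP[_ /imsetP[i _ ->] /exists_inP[_ /imsetP[j _ ->]]] := cP F FP.
by rewrite (ec i j) eqxx.
Qed.

Theorem theorem2 (r t : nat) (H : 'I_t -> hypergraph)
    (hr : 2 <= r) (ht : 1 <= t)
    (hH : forall l : 'I_t, set0 \notin edges (H l)) :
  ((chi (cat_prod (fun l : 'I_t => KG r (H l))))%:R >=
     1 / (r%:R - 1) *
     (min_over (fun l : 'I_t => #|vertex (H l)| - alt r (H l))%N)%:R :> rat)%R.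
Proof.
have r1 : (r%:R - 1 = r.-1%:R :> rat)%R.
  by rewrite -{1}(prednK (ltnW hr)) -natr1 addrK.
rewrite r1 mul1r mulrC ler_pdivrMr ?ltr0n -?subn1 ?subn_gt0 // subn1.
by rewrite -natrM ler_nat mulnC min_le_chi.
Qed.
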